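(* Let $H_1,\dots,H_N$ be complex Hilbert spaces whose dimensions $n_k=\dim H_k$ satisfy $n_1\le n_2\le\cdots\le n_N$ and $n_{N-1}<\infty$ ($H_N$ is allowed to be infinite dimensional). Let $V$ be the set of decomposable unit vectors in $H_1\otimes\cdots\otimes H_N$. For every $\xi\in H_1\otimes\cdots\otimes H_N$, let $F_\xi$ be the element of the dual of the projective tensor product $H_1\hat\otimes\cdots\hat\otimes H_N$ defined by $$F_\xi(\eta_1\otimes\cdots\otimes\eta_N)=\langle\eta_1\otimes\cdots\otimes\eta_N,\xi\rangle .$$ Then the norms $\|\cdot\|_V$ and $\|\cdot\|^V$ are given by $$\|\xi\|_V=\|F_\xi\|,\qquad\|\xi\|^V=\|\xi\|_\gamma,\qquad\xi\in H_1\otimes\cdots\otimes H_N .$$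
   Context: $H=H_1\otimes\cdots\otimes H_N$ is the Hilbert space tensor product (which, since at most one factor is infinite dimensional, coincides as a vector space with the algebraic tensor product). $V=\{\xi_1\otimes\cdots\otimes\xi_N:\xi_k\in H_k,\ \|\xi_1\|=\cdots=\|\xi_N\|=1\}$. For $\xi\in H$: $\|\xi\|_V=\sup_{\eta\in V}|\langle\xi,\eta\rangle|$ and $\|\xi\|^V=\sup\{|\langle\xi,\eta\rangle|:\eta\in H,\ \|\eta\|_V\le1\}$. The projective norm (or greatest cross norm) of an element $z$ of the algebraic tensor product is defined as $\|z\|_\gamma=\inf\sum_{k=1}^n\|x_1^k\|\,\|x_2^k\|\cdots\|x_N^k\|$, the infimum extended over all representations of $z$ of the form $z=\sum_{k=1}^nx_1^k\otimes\cdots\otimes x_N^k$ with $1\le n\le n_1n_2\cdots n_{N-1}$ and $x_j^k\in H_j$, $j=1,\dots,N$. The projective tensor product $H_1\hat\otimes\cdots\hat\otimes H_N$ is the algebraic tensor product regarded as a Banach space with the norm $\|\cdot\|_\gamma$, and $\|F_\xi\|$ is the norm of $F_\xi$ in its dual.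
   Formalization: The projective norm is taken over representations with any number n of terms, without the bound n ≤ n_1⋯n_{N−1}, since with that bound ‖ξ‖^V = ‖ξ‖_γ fails (e.g. dimensions 3, 4, 12); all n_k ≥ 1 is made explicit. *)

(* Defs.v *)
From HB Require Import structures.
From mathcomp Require Import all_boot all_order all_algebra.
From mathcomp Require Import sesquilinear.
From mathcomp Require Import all_classical all_reals.
From mathcomp Require Import ereal topology normedtype.
From mathcomp Require Import complex.

Set Implicit Arguments.
Unset Strict Implicit.
Unset Printing Implicit Defensive.

Import Order.TTheory GRing.Theory Num.Theory.
Import numFieldNormedType.Exports.

Local Open Scope classical_set_scope.
Local Open Scope ring_scope.
Local Open Scope complex_scope.

(* [{dot V for conj}] is linear in its first argument and conjugate linear in
   its second one. *)
HB.mixin Record isHilbert (R : realType) V of CompleteNormedModule R[i] V := {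
  hdot : {dot V for (@Num.conj R[i])} ;
  hdot_norm : forall x : V, `|x| ^+ 2 = hdot x x
}.

#[short(type="hilbertType")]
HB.structure Definition Hilbert (R : realType) :=
  {V of CompleteNormedModule R[i] V & isHilbert R V}.

(* The norms of the library are [R[i]]-valued; suprema are taken in [\bar R]. *)
Definition rnorm (R : realType) (V : normedModType R[i]) (x : V) : R :=
  complex.Re `|x|.

Definition modulus (R : realType) (z : R[i]) : R := complex.Re `|z|.

(* The Hilbert dimension, i.e. the cardinality of a maximal orthonormal family,
   with [+oo] standing for every infinite cardinal. *)
Definition hdim (R : realType) (V : hilbertType R) : \bar R :=
  ereal_sup [set n%:R%:E | n in [set n : nat |
    exists e : 'I_n -> V, forall i j, hdot (e i) (e j) = (i == j)%:R]].

Section Tensor.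
Variables (R : realType) (N : nat) (H : 'I_N -> hilbertType R).
Variables (T : hilbertType R) (tens : (forall k, H k) -> T).

Definition multilinear : Prop :=
  forall (x : forall k, H k) (k : 'I_N) (a : R[i]) (u v : H k),
    tens (eqtype.dfwith x (a *: u + v)) =
    a *: tens (eqtype.dfwith x u) + tens (eqtype.dfwith x v).

(* The image in [T] of the algebraic tensor product of the [H k]; the map is
   injective when [tens] has the inner products below. *)
Definition algebraic_tensors : set T :=
  [set z | exists (n : nat) (x : 'I_n -> forall k, H k),
    z = \sum_(i < n) tens (x i)].

(* [T], with [tens x] as [x_1 (x) ... (x) x_N], is the completion of the
   algebraic tensor product for the product inner product; this determines
   [(T, tens)] up to a unique unitary. *)
Definition hilbert_tensor_product : Prop :=
  [/\ multilinear,
      forall x y, hdot (tens x) (tens y) = \prod_(k < N) hdot (x k) (y k) &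
      dense algebraic_tensors].

Definition decomposable_unit : set T :=
  [set v | exists x : forall k, H k,
    (forall k, rnorm (x k) = 1) /\ v = tens x].

Definition normV (xi : T) : \bar R :=
  ereal_sup [set (modulus (hdot xi eta))%:E | eta in decomposable_unit].

Definition dual_normV (xi : T) : \bar R :=
  ereal_sup [set (modulus (hdot xi eta))%:E
            | eta in [set eta | (normV eta <= 1)%E]].

(* The number [n] of terms is not bounded: the infimum over the representations
   with at most [n_1 ... n_(N-1)] terms is not a norm in general, and can be
   larger than the greatest cross norm. *)
Definition projective_norm (z : T) : \bar R :=
  ereal_inf [set r | exists (n : nat) (x : 'I_n -> forall k, H k),
    [/\ (1 <= n)%N, z = \sum_(i < n) tens (x i) &
        r = (\sum_(i < n) \prod_(k < N) rnorm (x i k))%:E]].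

(* Norm of a functional on the projective tensor product. When all the [H k] but
   one are finite dimensional, [T] coincides with [algebraic_tensors], so the
   functional is defined on all of [T]; elsewhere the projective norm is [+oo]. *)
Definition projective_dual_norm (F : T -> R[i]) : \bar R :=
  ereal_sup [set (modulus (F z))%:E
            | z in [set z | (projective_norm z <= 1)%E]].

Definition in_projective_dual (F : T -> R[i]) : Prop :=
  scalar F /\ (projective_dual_norm F < +oo)%E.

Definition defines_F (xi : T) (F : T -> R[i]) : Prop :=
  in_projective_dual F /\ forall eta, F (tens eta) = hdot (tens eta) xi.

End Tensor.

(* Main.v *)
Require Import Defs.
From HB Require Import structures.
From mathcomp Require Import all_boot all_order all_algebra.
From mathcomp Require Import sesquilinear.
From mathcomp Require Import all_classical all_reals.
From mathcomp Require Import ereal topology normedtype.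
From mathcomp Require Import complex.
From mathcomp Require Import ring lra.

(* All slots but the last have finite orthonormal bases, so [T] is a finite
   orthogonal sum of copies of the last factor.  Hence every vector is a finite
   sum of decomposable ones, and the cost of the cheapest such sum is at most a
   constant times the Hilbert norm.  The pairing of [normV] with the cost of
   decompositions then gives [normV xi = |F_xi|] and
   [dual_normV xi <= projective_norm xi].  For the converse, the vectors
   admitting a decomposition of cost at most [r < projective_norm xi] form a
   bounded convex balanced set at positive distance from [xi]; separating it from
   [xi] inside the Hilbert space directly produces a vector [eta] with
   [normV eta <= 1] and [|<xi, eta>| >= r], so that neither the Hahn-Banach nor
   the Riesz theorem is needed. *)

(** * Real-valued modulus of complex numbers *)

Section Modulus.
Import Order.TTheory GRing.Theory Num.Theory.
Local Open Scope ring_scope.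
Local Open Scope complex_scope.
Context {R : realType}.
Implicit Types z w : R[i].

Lemma normc_modulus z : `|z| = (modulus z)%:C.
Proof. by rewrite /modulus normc_def. Qed.

Lemma modulus_ge0 z : 0 <= modulus z.
Proof. by rewrite -ler0c -normc_modulus. Qed.

Lemma modulusM z w : modulus (z * w) = modulus z * modulus w.
Proof. by apply: complexI; rewrite rmorphM /= -!normc_modulus normrM. Qed.

Lemma ler_modulusD z w : modulus (z + w) <= modulus z + modulus w.
Proof. by rewrite -lecR rmorphD -!normc_modulus ler_normD. Qed.

Lemma modulus_conj z : modulus (Num.conj z) = modulus z.
Proof. by rewrite /modulus norm_conjC. Qed.

Lemma modulus_real (x : R) : 0 <= x -> modulus x%:C = x.
Proof. by move=> x0; rewrite /modulus ger0_norm ?ler0c. Qed.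

Lemma modulus0 : modulus (0 : R[i]) = 0.
Proof. by rewrite -[0]/(0%:C) modulus_real. Qed.

Lemma Re_le_modulus z : complex.Re z <= modulus z.
Proof.
rewrite /modulus normc_def /=; apply: le_trans (ler_norm _) _.
by rewrite -sqrtr_sqr ler_sqrt ?lerDl ?addr_ge0 ?sqr_ge0.
Qed.

(** Turns a bound on real parts over a set stable under such factors into a bound on moduli. For
    [z = 0] the factor is 0, hence the inequality on [modulus c]. *)
Lemma exists_phase z : exists2 c : R[i], modulus c <= 1 & c * z = (modulus z)%:C.
Proof.
have [->|z0] := eqVneq z 0.
  by exists 0; rewrite ?modulus0 ?ler01// mul0r.
exists (`|z| / z); last by rewrite -mulrA mulVf // mulr1 normc_modulus.
by rewrite -lecR -normc_modulus normrM normr_id normfV divff ?normr_eq0.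
Qed.

Lemma ReD z w : complex.Re (z + w) = complex.Re z + complex.Re w.
Proof. by case: z w => [a b] [c d]. Qed.

Lemma Re_realM (x : R) z : complex.Re (x%:C * z) = x * complex.Re z.
Proof. by case: z => a b /=; rewrite mul0r subr0. Qed.

End Modulus.

(** * Inner product, norm and the Cauchy-Schwarz inequality *)

Section HilbertBasics.
Import Order.TTheory GRing.Theory Num.Theory.
Local Open Scope ring_scope.
Local Open Scope complex_scope.
Context {R : realType} {V : hilbertType R}.
Implicit Types (x y z : V) (c : R[i]).

Lemma norm_rnorm x : `|x| = (rnorm x)%:C.
Proof. by rewrite /rnorm RRe_real // ger0_real. Qed.

Lemma rnorm_ge0 x : 0 <= rnorm x.
Proof. by rewrite -ler0c -norm_rnorm. Qed.

Lemma rnorm0 : rnorm (0 : V) = 0.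
Proof. by rewrite /rnorm normr0. Qed.

Lemma rnorm_eq0 x : rnorm x = 0 -> x = 0.
Proof. by move=> x0; apply/normr0_eq0; rewrite norm_rnorm x0. Qed.

Lemma ler_rnormD x y : rnorm (x + y) <= rnorm x + rnorm y.
Proof.
by rewrite -lecR rmorphD /= -!norm_rnorm ler_normD. Qed.

Lemma rnormZ c x : rnorm (c *: x) = modulus c * rnorm x.
Proof.
by apply: complexI; rewrite rmorphM /= -!norm_rnorm -normc_modulus normrZ.
Qed.

Lemma rnormB x y : rnorm (x - y) = rnorm (y - x).
Proof. by rewrite /rnorm distrC. Qed.

Lemma ler_rnorm_sum (I : Type) (r : seq I) (P : pred I) (F : I -> V) :
  rnorm (\sum_(i <- r | P i) F i) <= \sum_(i <- r | P i) rnorm (F i).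
Proof.
apply: (big_ind2 (fun x s => rnorm x <= s)) => [|x s y t xs yt|//].
  by rewrite rnorm0.
exact: le_trans (ler_rnormD _ _) (lerD xs yt).
Qed.

Lemma hdotDl x y z : hdot (x + y) z = hdot x z + hdot y z.
Proof. exact: linearDl. Qed.

Lemma hdotZl c x y : hdot (c *: x) y = c * hdot x y.
Proof. exact: linearZl_LR. Qed.

Lemma hdotBl x y z : hdot (x - y) z = hdot x z - hdot y z.
Proof. exact: linearBl. Qed.

Lemma hdot_conj x y : hdot x y = Num.conj (hdot y x).
Proof. by rewrite {1}hermitian_subproof expr0 mul1r. Qed.

Lemma hdotZr c x y : hdot x (c *: y) = Num.conj c * hdot x y.
Proof. exact: linearZr_LR. Qed.

Lemma hdotBr x y z : hdot x (y - z) = hdot x y - hdot x z.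
Proof. exact: linearBr. Qed.

Lemma hdot0l x : hdot 0 x = 0. Proof. exact: linear0l. Qed.

Lemma hdot0r x : hdot x 0 = 0. Proof. exact: linear0r. Qed.

Lemma hdot_suml (I : Type) (r : seq I) (P : pred I) (F : I -> V) y :
  hdot (\sum_(i <- r | P i) F i) y = \sum_(i <- r | P i) hdot (F i) y.
Proof. exact: linear_sumlz. Qed.

Lemma hdotxx x : hdot x x = (rnorm x ^+ 2)%:C.
Proof. by rewrite -hdot_norm norm_rnorm rmorphXn. Qed.

Lemma modulus_hdotC x y : modulus (hdot x y) = modulus (hdot y x).
Proof. by rewrite hdot_conj modulus_conj. Qed.

Lemma cauchy_schwarz x y : modulus (hdot x y) <= rnorm x * rnorm y.
Proof.
have [->|y0] := eqVneq y 0.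
  by rewrite hdot0r modulus0 mulr_ge0 ?rnorm_ge0.
have ny : rnorm y != 0 by apply: contra_neq y0 => /rnorm_eq0.
have hy : hdot y y != 0.
  by rewrite hdotxx -[0]/(0%:C) (inj_eq (@complexI R)) expf_neq0.
(* [a *: y] is the orthogonal projection of [x] on the line of [y]; the squared norm of the
   remainder is nonnegative, which is the claim after clearing denominators. *)
set a := hdot x y / hdot y y.
have oy : hdot (x - a *: y) y = 0 by rewrite hdotBl hdotZl divfK ?subrr.
have : hdot (x - a *: y) (x - a *: y) =
    (rnorm x ^+ 2 - modulus (hdot x y) ^+ 2 / rnorm y ^+ 2)%:C.
  rewrite hdotBr hdotZr oy mulr0 subr0 hdotBl hdotZl hdotxx rmorphB.
  congr (_ - _); rewrite fmorph_div rmorphXn /= -normc_modulus normCK.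
  rewrite -hdotxx. by rewrite [hdot y x]hdot_conj /a mulrAC.
rewrite hdotxx => /complexI h.
have : 0 <= rnorm x ^+ 2 - modulus (hdot x y) ^+ 2 / rnorm y ^+ 2.
  by rewrite -h sqr_ge0.
rewrite subr_ge0 ler_pdivrMr ?exprn_gt0 ?lt_def ?ny ?rnorm_ge0 // -exprMn.
by rewrite ler_pXn2r // nnegrE ?mulr_ge0 ?modulus_ge0 ?rnorm_ge0.
Qed.

Lemma rnormB_sqr x y :
  rnorm (x - y) ^+ 2 = rnorm x ^+ 2 - 2 * complex.Re (hdot y x) + rnorm y ^+ 2.
Proof.
have E (u : V) : rnorm u ^+ 2 = complex.Re (hdot u u) by rewrite hdotxx.
rewrite !E hdotBr !hdotBl [hdot x y]hdot_conj.
case: (hdot y x) (hdot x x) (hdot y y) => [a b] [c d] [e f] /=; ring.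
Qed.

End HilbertBasics.

(** * Orthonormal bases in finite Hilbert dimension *)

Section FiniteHilbertDimension.
Import Order.TTheory GRing.Theory Num.Theory.
Local Open Scope ring_scope.
Local Open Scope complex_scope.
Context {R : realType} {V : hilbertType R}.

Lemma orthonormal_extend (n : nat) (e : 'I_n -> V) (u : V) :
  (forall i j, hdot (e i) (e j) = (i == j)%:R) ->
  u != 0 -> (forall i, hdot u (e i) = 0) ->
  exists e' : 'I_n.+1 -> V, forall i j, hdot (e' i) (e' j) = (i == j)%:R.
Proof.
move=> e_on u0 ue.
have nu : rnorm u != 0 by apply: contra_neq u0 => /rnorm_eq0.
pose w := (rnorm u)^-1%:C *: u.
have we i : hdot w (e i) = 0 by rewrite hdotZl ue mulr0.
have ew i : hdot (e i) w = 0 by rewrite hdot_conj we rmorph0.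
have ww : hdot w w = 1.
  rewrite hdotxx rnormZ modulus_real ?invr_ge0 ?rnorm_ge0 //.
  by rewrite mulVf // expr1n.
exists (fun i => if unlift ord_max i is Some j then e j else w) => i j.
case: unliftP => [i' ->|->]; case: unliftP => [j' ->|->].
- by rewrite e_on (inj_eq lift_inj).
- by rewrite ew eq_sym (negPf (neq_lift _ _)).
- by rewrite we (negPf (neq_lift _ _)).
- by rewrite ww eqxx.
Qed.

Lemma hdim_unit_vector : (1 <= hdim V)%E -> exists u : V, rnorm u = 1.
Proof.
move=> V1; have /ereal_sup_gt[_ [[|n] [e e_on] <-]] : (0 < hdim V)%E.
  exact: lt_le_trans V1.
  by rewrite ltxx.
move=> _; exists (e ord0); apply/eqP; rewrite -sqrp_eq1 ?rnorm_ge0 //.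
by rewrite -(inj_eq (@complexI R)) -hdotxx e_on eqxx.
Qed.

(** A finite dimension bounds the size of orthonormal families, so one of maximal size exists. The
    remainder of [x] after its expansion is orthogonal to the family, and would enlarge it if it
    were nonzero. *)
Lemma finite_hdim_basis : (hdim V < +oo)%E ->
  exists (n : nat) (e : 'I_n -> V),
    (forall i j, hdot (e i) (e j) = (i == j)%:R) /\
    (forall x, x = \sum_i hdot x (e i) *: e i).
Proof.
move=> Vfin.
pose A n := `[< exists e : 'I_n -> V, forall i j, hdot (e i) (e j) = (i == j)%:R >].
have leV n : A n -> (n%:R%:E <= hdim V)%E.
  by move=> /asboolP An; apply: ereal_sup_ubound; exists n.
have A0 : A 0 by apply/asboolP; exists (fun=> 0); case.
have hV : hdim V \is a fin_num.
  by rewrite ge0_fin_numE //; apply: (leV 0).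
have Abd n : A n -> (n <= Num.truncn (fine (hdim V)))%N.
  move=> /leV; rewrite -(fineK hV) lee_fin => nV.
  by rewrite truncn_ge_nat // (le_trans _ nV) // ler0n.
case: (ex_maxnP (ex_intro _ 0%N A0) Abd) => n /asboolP[e e_on] nmax.
exists n, e; split=> // x; apply/eqP; rewrite -subr_eq0; apply: contraT => u0.
have ue i : hdot (x - \sum_i hdot x (e i) *: e i) (e i) = 0.
  rewrite hdotBl hdot_suml (bigD1 i) //= hdotZl e_on eqxx mulr1.
  rewrite big1 ?addr0 ?subrr // => j ji.
  by rewrite hdotZl e_on (negPf ji) mulr0.
have := nmax n.+1; rewrite ltnn; apply.
exact/asboolP/(orthonormal_extend _ _ _ e_on u0 ue).
Qed.

End FiniteHilbertDimension.

(** * Finite decompositions in the Hilbert tensor product *)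

Section TensorProduct.
Import Order.TTheory GRing.Theory Num.Theory.
Import numFieldNormedType.Exports.
Local Open Scope classical_set_scope.
Local Open Scope ring_scope.
Local Open Scope complex_scope.
Context {R : realType} {N : nat} {H : 'I_N -> hilbertType R}.
Context {T : hilbertType R} {tens : (forall k, H k) -> T}.
Hypothesis hT : hilbert_tensor_product tens.

Lemma dfwithxx (x : forall k, H k) k : eqtype.dfwith x (x k) = x.
Proof.
apply: functional_extensionality_dep => j.
by case: (eqtype.dfwithP x (x k) j).
Qed.

Lemma tens0 (x : forall k, H k) k : tens (eqtype.dfwith x (0 : H k)) = 0.
Proof.
have [/(_ x k 1 0 0) + _ _] := hT.
rewrite !scale1r addr0 => /eqP.
by rewrite -subr_eq0 opprD addrA subrr sub0r oppr_eq0 => /eqP.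
Qed.

Lemma tensZ (x : forall k, H k) k a (u : H k) :
  tens (eqtype.dfwith x (a *: u)) = a *: tens (eqtype.dfwith x u).
Proof.
by have [/(_ x k a u 0) + _ _] := hT; rewrite tens0 !addr0.
Qed.

Lemma tensD (x : forall k, H k) k (u v : H k) :
  tens (eqtype.dfwith x (u + v)) =
    tens (eqtype.dfwith x u) + tens (eqtype.dfwith x v).
Proof.
by have [/(_ x k 1 u v) + _ _] := hT; rewrite !scale1r.
Qed.

Lemma tens_sum (x : forall k, H k) k (I : Type) (r : seq I) (F : I -> H k) :
  tens (eqtype.dfwith x (\sum_(i <- r) F i)) =
    \sum_(i <- r) tens (eqtype.dfwith x (F i)).
Proof.
apply: (big_morph (fun u => tens (eqtype.dfwith x u))) => [u v|].
  exact: tensD.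
exact: tens0.
Qed.

Lemma hdot_tens (x y : forall k, H k) :
  hdot (tens x) (tens y) = \prod_(k < N) hdot (x k) (y k).
Proof. by have [_ + _] := hT; apply. Qed.

Lemma rnorm_tens (x : forall k, H k) : rnorm (tens x) = \prod_(k < N) rnorm (x k).
Proof.
apply/eqP; rewrite -(@eqrXn2 _ 2) ?rnorm_ge0 ?prodr_ge0 //; last first.
  by move=> k _; exact: rnorm_ge0.
rewrite -(inj_eq (@complexI R)) -hdotxx hdot_tens -prodrXl rmorph_prod.
by apply/eqP/eq_bigr => k _; rewrite hdotxx.
Qed.

(** Intermediate stage in replacing the factors of [x] by basis vectors, one slot at a time from the
    left. *)
Definition mix j (g x : forall k, H k) : forall k, H k :=
  fun k => if (k < j)%N then g k else x k.

(** Induction on [j]: expanding slot [j] in an orthonormal basis multiplies the index set by that of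
    the basis, and multilinearity pulls out the coefficients. *)
Lemma orthonormal_frames (j : nat) : (j <= N)%N ->
  (forall k : 'I_N, (k < j)%N -> (hdim (H k) < +oo)%E) ->
  exists (M : finType) (g : M -> forall k, H k),
    (forall a b, \prod_(k < N | (k < j)%N) hdot (g a k) (g b k) = (a == b)%:R) /\
    (forall x, exists c : M -> R[i],
      tens x = \sum_a c a *: tens (mix j (g a) x)).
Proof.
elim: j => [_ _|j IH jN fin].
  (* No slot is replaced yet: one frame is enough, and its values are never read because [mix 0]
     returns [x]. *)
  exists unit, (fun _ _ => 0); split=> [[] []|x]; first by rewrite big_pred0.
  exists (fun=> 1); by rewrite (big_pred1 tt) ?scale1r // => -[].
have [|M [g [g_on g_span]]] := IH (ltnW jN).
  by move=> k kj; apply: fin; exact: ltnW.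
pose kj := Ordinal jN.
have [n [e [e_on e_span]]] := finite_hdim_basis (fin kj (ltnSn j)).
exists (M * 'I_n)%type, (fun p => eqtype.dfwith (g p.1) (e p.2 : H kj)); split.
  move=> [a i] [b l] /=.
  rewrite (bigD1 kj) //= !eqtype.dfwith_in e_on.
  rewrite (eq_big (fun k : 'I_N => (k < j)%N) (fun k => hdot (g a k) (g b k))).
  - by rewrite g_on xpair_eqE -natrM mulnb andbC.
  - move=> k; rewrite ltnS (leq_eqVlt k) -val_eqE /=.
    by case: ltngtP.
  - move=> k /andP[_ kk]; rewrite !eqtype.dfwith_out // eq_sym //.
move=> x; have [c cx] := g_span x.
exists (fun p => c p.1 * hdot (x kj) (e p.2)).
rewrite cx -(pair_bigA _ (fun a i => (c a * hdot (x kj) (e i)) *: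
  tens (mix j.+1 (eqtype.dfwith (g a) (e i : H kj)) x))) /=.
apply: eq_bigr => a _; rewrite -{1}[mix j (g a) x](dfwithxx _ kj).
have -> : mix j (g a) x kj = \sum_i hdot (x kj) (e i) *: e i.
  by rewrite /mix ltnn -e_span.
rewrite tens_sum scaler_sumr; apply: eq_bigr => i _.
rewrite tensZ scalerA; congr (_ *: tens _).
apply: functional_extensionality_dep => k; rewrite /mix ltnS leq_eqVlt.
have [->|kk] := eqVneq k kj; first by rewrite !eqtype.dfwith_in eqxx.
have /negPf -> : (k != j :> nat) by [].
by rewrite !eqtype.dfwith_out // eq_sym.
Qed.

(** Frames on all slots but the last give pairwise orthogonal copies of [H l]; the coefficient of
    each frame is absorbed into the last factor. *)
Lemma last_slot_frames (l : 'I_N) : l.+1 = N ->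
  (forall k : 'I_N, k != l -> (hdim (H k) < +oo)%E) ->
  exists (M : finType) (g : M -> forall k, H k),
    (forall a b (u v : H l),
      hdot (tens (eqtype.dfwith (g a) u)) (tens (eqtype.dfwith (g b) v)) =
      (a == b)%:R * hdot u v) /\
    (forall x, exists u : M -> H l,
      tens x = \sum_a tens (eqtype.dfwith (g a) (u a))).
Proof.
move=> lN fin.
have ltl (k : 'I_N) : (k < l)%N = (k != l).
  by rewrite ltn_neqAle -ltnS lN ltn_ord andbT.
have [|M [g [g_on g_span]]] := orthonormal_frames l (ltnW (ltn_ord l)).
  by move=> k; rewrite ltl => /fin.
exists M, g; split=> [a b u v|x].
  rewrite hdot_tens (bigD1 l) //= !eqtype.dfwith_in mulrC; congr (_ * _).
  rewrite -g_on; apply: eq_big => k; first by rewrite ltl.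
  by move=> kl; rewrite !eqtype.dfwith_out // eq_sym.
have [c ->] := g_span x.
exists (fun a => c a *: x l); apply: eq_bigr => a _; rewrite tensZ.
congr (_ *: tens _); apply: functional_extensionality_dep => k; rewrite /mix ltl.
have [->|kl] := eqVneq k l; first by rewrite eqtype.dfwith_in.
by rewrite eqtype.dfwith_out // eq_sym.
Qed.

(** [s] is the cost of one decomposition of [z]. By [rnorm_tens] it is a sum of products of norms,
    so [projective_norm] is the infimum of these costs. *)
Definition atomic_sum (z : T) (s : R) : Prop :=
  exists r : seq (forall k, H k),
    z = \sum_(x <- r) tens x /\ s = \sum_(x <- r) rnorm (tens x).

Lemma atomic_sum_tens x : atomic_sum (tens x) (rnorm (tens x)).
Proof. by exists [:: x]; rewrite !big_seq1. Qed.

Lemma atomic_sum0 : atomic_sum 0 0.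
Proof. by exists [::]; rewrite !big_nil. Qed.

Lemma atomic_sumD z s w t :
  atomic_sum z s -> atomic_sum w t -> atomic_sum (z + w) (s + t).
Proof.
by move=> [r [-> ->]] [r' [-> ->]]; exists (r ++ r'); rewrite !big_cat.
Qed.

(** The scalar is absorbed by slot [k] of every term. *)
Lemma atomic_sumZ (k : 'I_N) c z s :
  atomic_sum z s -> atomic_sum (c *: z) (modulus c * s).
Proof.
move=> [r [-> ->]].
pose f (x : forall k, H k) : forall k, H k := eqtype.dfwith x (c *: x k).
exists [seq f x | x <- r].
have cx x : tens (f x) = c *: tens x.
  by rewrite /f tensZ dfwithxx.
rewrite !big_map scaler_sumr mulr_sumr; split; apply: eq_bigr => x _ //.
by rewrite cx rnormZ.
Qed.

Lemma atomic_sum_bigop (I : Type) (r : seq I) (z : I -> T) (s : I -> R) :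
  (forall i, atomic_sum (z i) (s i)) ->
  atomic_sum (\sum_(i <- r) z i) (\sum_(i <- r) s i).
Proof.
move=> zs; apply: (big_ind2 atomic_sum) => //; first exact: atomic_sum0.
by move=> *; exact: atomic_sumD.
Qed.

Lemma rnorm_atomic_sum z s : atomic_sum z s -> rnorm z <= s.
Proof. by move=> [r [-> ->]]; exact: ler_rnorm_sum. Qed.

(* The components of [xi] in the orthogonal pieces [g_a (x) H_l] are limits, in
   the complete space [H_l], of those of algebraic tensors close to [xi]. *)
Lemma tensor_decomposition (l : 'I_N) (M : finType) (g : M -> forall k, H k) :
    (forall a b (u v : H l),
      hdot (tens (eqtype.dfwith (g a) u)) (tens (eqtype.dfwith (g b) v)) =
      (a == b)%:R * hdot u v) ->
    (forall x, exists u : M -> H l,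
      tens x = \sum_a tens (eqtype.dfwith (g a) (u a))) ->
  forall xi, exists u : M -> H l,
    xi = \sum_a tens (eqtype.dfwith (g a) (u a)) /\
    (forall a, rnorm (tens (eqtype.dfwith (g a) (u a))) <= rnorm xi).
Proof.
move=> g_on g_span xi.
pose J a (u : H l) := tens (eqtype.dfwith (g a) u).
have JB a u v : J a (u - v) = J a u - J a v.
  by rewrite /J tensD -scaleN1r tensZ scaleN1r.
have Jn a u : rnorm (J a u) = rnorm u.
  apply/eqP; rewrite -(@eqrXn2 _ 2) ?rnorm_ge0 // -(inj_eq (@complexI R)).
  by rewrite -!hdotxx g_on eqxx mul1r.
(* Pairing the sum with its own piece [b] leaves, by orthogonality, the square of [rnorm (u b)];
   Cauchy-Schwarz and a division by [rnorm (u b)] conclude. *)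
have Jle (u : M -> H l) b : rnorm (u b) <= rnorm (\sum_a J a (u a)).
  have [ub0|ub0] := eqVneq (rnorm (u b)) 0; first by rewrite ub0 rnorm_ge0.
  rewrite -(@ler_pM2r _ (rnorm (u b))); last by rewrite lt_def ub0 rnorm_ge0.
  rewrite -{3}(Jn b) -expr2 -[leLHS]modulus_real ?sqr_ge0 // -hdotxx.
  suff -> : hdot (u b) (u b) = hdot (\sum_a J a (u a)) (J b (u b)).
    exact: cauchy_schwarz.
  rewrite hdot_suml (bigD1 b) //= g_on eqxx mul1r big1 ?addr0 // => a ab.
  by rewrite g_on (negPf ab) mul0r.
(* The default 0 outside the algebraic tensors makes the components a total function of [z], as
   [choice] requires. *)
have algJ z : exists u : M -> H l,
    algebraic_tensors tens z -> z = \sum_a J a (u a).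
  have [[n [x ->]]|nz] := pselect (algebraic_tensors tens z); last by exists (fun=> 0).
  have [u ux] := choice (fun i => g_span (x i)).
  exists (fun a => \sum_i u i a) => _.
  rewrite (eq_bigr _ (fun i _ => ux i)) exchange_big; apply: eq_bigr => a _.
  by rewrite /J tens_sum.
have [h hJ] := choice algJ.
(* The component maps are 1-Lipschitz on algebraic tensors, so they carry the filter [F] below to
   Cauchy filters. *)
have hle z w b : algebraic_tensors tens z -> algebraic_tensors tens w ->
    rnorm (h z b - h w b) <= rnorm (z - w).
  move=> /hJ zE /hJ wE; apply: le_trans (Jle (fun a => h z a - h w a) b) _.
  by rewrite {2}zE {2}wE -sumrB (eq_bigr _ (fun a _ => JB a _ _)).
pose F := within (algebraic_tensors tens) (nbhs xi).
have [_ _ Tdense] := hT.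
have FP : ProperFilter F.
  apply: within_nbhs_proper => B.
  rewrite nbhsE => -[O [Oo Oxi] OB].
  have [z [Oz zalg]] := Tdense O (ex_intro _ xi Oxi) Oo.
  by exists z; split=> //; exact: OB.
have Falg : F (algebraic_tensors tens) by exact: withinT.
have Fball e : 0 < e -> F (ball xi e).
  by move=> e0; apply: filterS (nbhsx_ballx xi _ e0) => z + _.
have hcvg b : cvg ((fun z => h z b) @ F).
  apply/cauchy_cvgP/cauchy_exP => e e0.
  have [z0 [z0alg z0xi]] := filter_ex (filterI Falg (Fball _ (divr_gt0 e0 (ltr0n _ 2)))).
  exists (h z0 b); apply: filterS (filterI Falg (Fball _ (divr_gt0 e0 (ltr0n _ 2)))).
  move=> z [zalg zxi] /=.
  have := ball_splitr z0xi zxi.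
  rewrite -!ball_normE /= => /(le_lt_trans _); apply.
  by rewrite !norm_rnorm lecR hle.
pose u b : H l := lim ((fun z => h z b) @ F).
suff xiE : xi = \sum_a J a (u a).
  by exists u; split=> // b; rewrite Jn xiE Jle.
apply/eqP; rewrite -subr_eq0; apply/eqP/rnorm_eq0/eqP.
set d := xi - _; rewrite eq_le rnorm_ge0 andbT.
apply/ler_addgt0Pr => e e0; rewrite add0r.
(* The error [e] is cut into [#|M| + 1] equal parts, one for [xi - z] and one for each component. *)
have M0 : 0 < 1 + #|M|%:R :> R by rewrite ltr_pwDl ?ltr01 ?ler0n.
pose e' := e / (1 + #|M|%:R); have e'0 : 0 < e' by rewrite divr_gt0.
have e'C : 0 < e'%:C by rewrite ltcR.
have ulim : F [set z | forall a, ball (u a) e'%:C (h z a)].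
  apply: (@filter_forall _ _ (fun a z => ball (u a) e'%:C (h z a)) F) => a.
  by have /cvg_ballP := hcvg a; exact.
have [z [zalg [zxi zu]]] := filter_ex (filterI Falg (filterI (Fball _ e'C) ulim)).
have -> : d = (xi - z) + \sum_a J a (h z a - u a).
  rewrite (eq_bigr _ (fun a _ => JB a _ _)) sumrB -hJ // addrA subrK; by [].
apply: le_trans (ler_rnormD _ _) _.
have -> : e = e' + \sum_(a : M) e'.
  by rewrite sumr_const -mulr_natr -{1}[e']mulr1 -mulrDr divfK // gt_eqF.
apply: lerD.
  by move: zxi; rewrite -ball_normE /= norm_rnorm ltcR => /ltW.
apply: le_trans (ler_rnorm_sum _ _ _ _) _; apply: ler_sum => a _.
by move: (zu a); rewrite Jn rnormB -ball_normE /= norm_rnorm ltcR => /ltW.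
Qed.

(** [C] is the number of orthogonal pieces, since no piece of [xi] is longer than [xi]. It makes
    cost comparable to the Hilbert norm. *)
Lemma atomic_sum_bound (l : 'I_N) : l.+1 = N ->
  (forall k : 'I_N, k != l -> (hdim (H k) < +oo)%E) ->
  exists2 C : R, 0 <= C &
    forall xi, exists2 s, atomic_sum xi s & s <= C * rnorm xi.
Proof.
move=> lN fin; have [M [g [g_on g_span]]] := last_slot_frames l lN fin.
exists #|M|%:R => [|xi]; first exact: ler0n.
have [u [-> ule]] := tensor_decomposition l M g g_on g_span xi.
eexists; first by apply: atomic_sum_bigop => a; exact: atomic_sum_tens.
rewrite [leRHS]mulrC mulr_natr -sumr_const; apply: ler_sum => a _.
exact: ule.
Qed.

End TensorProduct.

(** * Separation of a point from a bounded convex set *)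

Section Separation.
Import Order.TTheory GRing.Theory Num.Theory.
Local Open Scope classical_set_scope.
Local Open Scope ring_scope.
Local Open Scope complex_scope.
Context {R : realType} {V : hilbertType R}.

(* An approximate nearest point [p] of [K] to [xi] is enough: the vector
   [xi - p] separates as soon as the defect of [p] is small. *)
Lemma separation (K : set V) (xi : V) (B d : R) :
    K !=set0 ->
    (forall p z (t : R), K p -> K z -> 0 <= t <= 1 -> K (p + t%:C *: (z - p))) ->
    (forall z, K z -> rnorm z <= B) ->
    0 < d -> (forall z, K z -> d <= rnorm (xi - z)) ->
  exists (eta : V) (c : R), c < complex.Re (hdot xi eta) /\
    forall z, K z -> complex.Re (hdot z eta) <= c.
Proof.
move=> [z0 Kz0] Kconv KB d0 Kd.
pose A := [set rnorm (xi - z) ^+ 2 | z in K].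
have Alb : lbound A 0 by move=> _ [z _ <-]; exact: sqr_ge0.
have Ainf : has_inf A.
  by split; [exists (rnorm (xi - z0) ^+ 2), z0 | exists 0].
(* [2 * B] bounds the diameter of [K]. This [t] is at most 1, so segments can be followed up to [t],
   and satisfies [t * (1 + (2 * B) ^+ 2) <= d ^+ 2]. *)
pose t := d ^+ 2 / (1 + (2 * B) ^+ 2 + d ^+ 2).
have d2 : 0 < d ^+ 2 by rewrite exprn_gt0.
have B2 : 0 <= (2 * B) ^+ 2 by exact: sqr_ge0.
have D0 : 0 < 1 + (2 * B) ^+ 2 + d ^+ 2 by lra.
have t0 : 0 < t by rewrite divr_gt0.
have t1 : t <= 1 by rewrite ler_pdivrMr // mul1r; lra.
have tB : t * (1 + (2 * B) ^+ 2) <= d ^+ 2.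
  by rewrite /t mulrAC ler_pdivrMr // ler_wpM2l ?ltW //; lra.
have t2 : 0 < t ^+ 2 by rewrite exprn_gt0.
have [_ [p Kp <-]] := inf_adherent t2 Ainf.
set eta := xi - p => pinf.
(* The level lies [d ^+ 2 / 2] above the value at [p], whereas the value at [xi] lies
   [rnorm eta ^+ 2 >= d ^+ 2] above it. *)
exists eta, (complex.Re (hdot p eta) + d ^+ 2 / 2).
have -> : hdot xi eta = hdot p eta + hdot eta eta by rewrite -hdotDl addrC subrK.
split.
  rewrite hdotxx ReD ltrD2l /=.
  have : d ^+ 2 <= rnorm eta ^+ 2 by rewrite ler_pXn2r ?nnegrE ?rnorm_ge0 ?Kd // ltW.
  lra.
move=> z Kz.
have zp : rnorm (z - p) ^+ 2 <= (2 * B) ^+ 2.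
  have B0 : 0 <= B by exact: le_trans (rnorm_ge0 _) (KB _ Kp).
  rewrite ler_pXn2r ?nnegrE ?rnorm_ge0 ?mulr_ge0 //.
  apply: le_trans (ler_rnormD _ _) _.
  have := KB _ Kz; have := KB _ Kp.
  by rewrite -(sub0r p) rnormB subr0; lra.
rewrite -{1}(subrK p z) hdotDl ReD addrC lerD2l.
(* The squared distance from [xi] to [p + t (z - p)] is at least the infimum, hence greater than
   [rnorm eta ^+ 2 - t ^+ 2]. Expanding it gives [2 * t * Q <= t ^+ 2 * (1 + (2 * B) ^+ 2)]. *)
have := ge_inf Ainf.2 (ex_intro2 _ _ _ (Kconv p z t Kp Kz _) erefl).
rewrite (ltW t0) t1 => /(_ isT).
rewrite opprD addrA rnormB_sqr hdotZl Re_realM rnormZ (modulus_real _ (ltW t0)) exprMn.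
rewrite -!/eta; set Q := complex.Re _ => infle.
have : t ^+ 2 * rnorm (z - p) ^+ 2 <= t ^+ 2 * (2 * B) ^+ 2.
  by apply: ler_wpM2l zp; exact: ltW.
move=> h; have : 2 * (t * Q) <= t * (t * (1 + (2 * B) ^+ 2)).
  by lra.
move=> h1; have : t * (2 * Q) <= t * d ^+ 2.
  by rewrite mulrCA; apply: le_trans h1 _; rewrite ler_pM2l.
rewrite ler_pM2l //; lra.
Qed.

End Separation.

(** * Costs of decompositions against the projective norm and [normV] *)

Section TensorNorms.
Import Order.TTheory GRing.Theory Num.Theory.
Local Open Scope classical_set_scope.
Local Open Scope ring_scope.
Local Open Scope complex_scope.
Context {R : realType} {N : nat} {H : 'I_N -> hilbertType R}.
Context {T : hilbertType R} {tens : (forall k, H k) -> T}.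
Hypothesis hT : hilbert_tensor_product tens.
Hypothesis N0 : (0 < N)%N.

Local Notation atomic_sum := (@atomic_sum R N H T tens).

Lemma projective_norm_le z s : atomic_sum z s -> (projective_norm tens z <= s%:E)%E.
Proof.
move=> [r [-> ->]]; apply: ereal_inf_lbound.
(* [projective_norm] wants at least one term, so a zero tensor of cost 0 is prepended in case the
   list is empty. *)
pose zero : forall k, H k := fun=> 0.
have t0 : tens zero = 0.
  by rewrite -(dfwithxx zero (Ordinal N0)) (tens0 hT).
exists (size r).+1, (tnth (in_tuple (zero :: r))); split=> //.
  by rewrite -(big_tnth _ _ (zero :: r) xpredT tens) big_cons t0 add0r.
congr (_%:E); under [RHS]eq_bigr => i _ do rewrite -(rnorm_tens hT).
rewrite -(big_tnth _ _ (zero :: r) xpredT (fun x => rnorm (tens x))).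
by rewrite big_cons t0 rnorm0 add0r.
Qed.

Lemma le_projective_norm z (b : \bar R) :
  (forall s, atomic_sum z s -> (b <= s%:E)%E) -> (b <= projective_norm tens z)%E.
Proof.
move=> bz; apply/ereal_infP => _ [n [x [_ zE ->]]].
under [X in X%:E]eq_bigr => i _ do rewrite -(rnorm_tens hT).
by apply: bz; rewrite zE; apply: atomic_sum_bigop => i; exact: atomic_sum_tens.
Qed.

(** Both sides have the same inner product with every [tens y]; their difference, a combination of
    two such tensors, is orthogonal to itself. This replaces an induction over the slots. *)
Lemma tens_scale (c : 'I_N -> R[i]) (x : forall k, H k) :
  tens (fun k => c k *: x k) = (\prod_k c k) *: tens x.
Proof.
have tsl (y : forall k, H k) :
    hdot (tens (fun k => c k *: x k)) (tens y) =
      (\prod_k c k) * hdot (tens x) (tens y).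
  rewrite !(hdot_tens hT) -big_split; apply: eq_bigr => k _.
  by rewrite hdotZl.
set u := tens _; apply/eqP; rewrite -subr_eq0; apply/eqP/rnorm_eq0.
have uy y : hdot (u - (\prod_k c k) *: tens x) (tens y) = 0.
  by rewrite hdotBl hdotZl tsl subrr.
apply/eqP; rewrite -sqrf_eq0 -(inj_eq (@complexI R)) -hdotxx.
by rewrite hdotBr hdotZr !uy mulr0 subrr.
Qed.

(** If [tens x] is nonzero, normalizing each factor turns it into a decomposable unit vector, to
    which the supremum applies. *)
Lemma normV_tens xi x (b : R) : 0 <= b -> (normV tens xi <= b%:E)%E ->
  modulus (hdot (tens x) xi) <= b * rnorm (tens x).
Proof.
move=> b0 xib; have [x0|x0] := eqVneq (rnorm (tens x)) 0.
  by rewrite (rnorm_eq0 _ x0) hdot0l modulus0 rnorm0 mulr0.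
have xk k : rnorm (x k) != 0.
  by apply: contraNneq x0 => xk0; rewrite (rnorm_tens hT) (bigD1 k) //= xk0 mul0r.
pose y k := (rnorm (x k))^-1%:C *: x k.
have yn k : rnorm (y k) = 1.
  by rewrite rnormZ modulus_real ?invr_ge0 ?rnorm_ge0 // mulVf.
have ty : tens y = (rnorm (tens x))^-1%:C *: tens x.
  rewrite (tens_scale (fun k => (rnorm (x k))^-1%:C)) -rmorph_prod.
  by rewrite (rnorm_tens hT) prodfV.
have : ((modulus (hdot xi (tens y)))%:E <= b%:E)%E.
  by apply: le_trans xib; apply: ereal_sup_ubound; exists (tens y) => //; exists y.
rewrite lee_fin modulus_hdotC ty hdotZl modulusM modulus_real ?invr_ge0 ?rnorm_ge0 //.
by rewrite mulrC ler_pdivrMr // lt_def x0 rnorm_ge0.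
Qed.

Lemma normV_atomic_sum xi (b : R) z s : 0 <= b -> (normV tens xi <= b%:E)%E ->
  atomic_sum z s -> modulus (hdot z xi) <= b * s.
Proof.
move=> b0 xib [r [-> ->]]; rewrite hdot_suml mulr_sumr.
apply: (big_ind2 (fun c t => modulus c <= t)) => [|c s1 d s2 cs ds|x _].
- by rewrite modulus0.
- exact: le_trans (ler_modulusD _ _) (lerD cs ds).
- exact: normV_tens.
Qed.

Lemma normV_le_rnorm xi : (normV tens xi <= (rnorm xi)%:E)%E.
Proof.
apply: ge_ereal_sup => _ [_ [x [x1 ->]] <-]; rewrite lee_fin.
apply: le_trans (cauchy_schwarz _ _) _.
by rewrite (rnorm_tens hT) big1 ?mulr1.
Qed.

Lemma projective_norm_unit x : (forall k, rnorm (x k) = 1) ->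
  (projective_norm tens (tens x) <= 1)%E.
Proof.
move=> x1; apply: le_trans (projective_norm_le _ _ (atomic_sum_tens x)) _.
by rewrite (rnorm_tens hT) big1.
Qed.

(** * The two norm identities when all slots but the last are finite dimensional *)

Section FiniteSlots.
Context (l : 'I_N).
Hypothesis lN : l.+1 = N.
Hypothesis fin : forall k : 'I_N, k != l -> (hdim (H k) < +oo)%E.

Lemma exists_atomic_sum z : exists s, atomic_sum z s.
Proof. by have [C _ /(_ z) [s zs _]] := atomic_sum_bound hT l lN fin; exists s. Qed.

Lemma normV_pairing xi (b : R) z : 0 <= b -> (normV tens xi <= b%:E)%E ->
  ((modulus (hdot z xi))%:E <= b%:E * projective_norm tens z)%E.
Proof.
(* [b = 0] is treated apart because the other case divides by [b] before passing to the infimum of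
   costs. *)
rewrite le_eqVlt => /predU1P[<-|b0] xib.
  have [s zs] := exists_atomic_sum z.
  by rewrite mul0e lee_fin -(mul0r s) (normV_atomic_sum xi).
rewrite -lee_pdivrMl //; apply: le_projective_norm => s zs.
rewrite -EFinM lee_fin mulrC ler_pdivrMr // mulrC.
by apply: normV_atomic_sum zs => //; exact: ltW.
Qed.

(** Every vector is a finite sum of decomposable ones, so linearity alone propagates the
    equality. *)
Lemma linear_functional_eq (F G : T -> R[i]) :
  scalar F -> scalar G -> (forall x, F (tens x) = G (tens x)) -> F = G.
Proof.
move=> Flin Glin FG; apply: funext => z.
have lin0 (K : T -> R[i]) : scalar K -> K 0 = 0.
  move=> /(_ 1 0 0); rewrite scaler0 addr0 mul1r => /eqP.
  by rewrite -subr_eq0 opprD addrA subrr sub0r oppr_eq0 => /eqP.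
have linD (K : T -> R[i]) u v : scalar K -> K (u + v) = K u + K v.
  by move=> /(_ 1 u v); rewrite scale1r mul1r.
have [s [r [-> _]]] := exists_atomic_sum z.
elim: r => [|x r IH]; first by rewrite !big_nil !lin0.
by rewrite !big_cons !linD // FG IH.
Qed.

Lemma defines_F_hdot xi : defines_F tens xi (fun z => hdot z xi).
Proof.
split=> //; split; first by move=> a u v; rewrite hdotDl hdotZl.
apply: (@le_lt_trans _ _ (rnorm xi)%:E); last exact: ltry.
apply: ge_ereal_sup => _ [z z1 <-].
apply: le_trans (normV_pairing _ _ z (rnorm_ge0 xi) (normV_le_rnorm xi)) _.
by rewrite -[leRHS]mule1 lee_wpmul2l // lee_fin rnorm_ge0.
Qed.

Lemma defines_F_unique xi F : defines_F tens xi F -> F = fun z => hdot z xi.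
Proof.
move=> [[Flin _] Fxi]; apply: linear_functional_eq => //.
by move=> a u v; rewrite hdotDl hdotZl.
Qed.

(** Unit tensors have projective norm at most 1, which gives one inequality; [normV_pairing] with
    [b = normV xi] gives the other. A unit tensor keeps [normV xi] from being [-oo]. *)
Lemma normV_eq_dual xi : decomposable_unit tens !=set0 ->
  normV tens xi = projective_dual_norm tens (fun z => hdot z xi).
Proof.
move=> [v Vv]; apply/eqP; rewrite eq_le; apply/andP; split.
  apply: ge_ereal_sup => _ [_ [x [x1 ->]] <-]; apply: ereal_sup_ubound.
  exists (tens x); first exact: projective_norm_unit.
  by rewrite modulus_hdotC.
have V0 : (0 <= normV tens xi)%E.
  apply: (@le_trans _ _ (modulus (hdot xi v))%:E); first by rewrite lee_fin modulus_ge0.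
  by apply: ereal_sup_ubound; exists v.
have Vfin : normV tens xi \is a fin_num.
  by rewrite ge0_fin_numE // (le_lt_trans (normV_le_rnorm xi)) ?ltry.
apply: ge_ereal_sup => _ [z z1 <-]; rewrite -(fineK Vfin).
apply: (le_trans (normV_pairing xi (fine (normV tens xi)) z _ _)).
- exact: fine_ge0.
- by rewrite fineK.
- by rewrite -[leRHS]mule1 lee_wpmul2l // lee_fin fine_ge0.
Qed.

Lemma dual_normV_witness xi (r d : R) : 0 < r -> 0 < d ->
  (forall s, atomic_sum xi s -> r + d <= s) ->
  exists eta, (normV tens eta <= 1)%E /\ r <= modulus (hdot xi eta).
Proof.
move=> r0 d0 rxi.
have [C C0 Cbd] := atomic_sum_bound hT l lN fin.
pose K := [set z : T | exists2 s, s <= r & atomic_sum z s].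
have K0 : K 0 by exists 0; [exact: ltW|exact: atomic_sum0].
have Kconv (p z : T) (t : R) : K p -> K z -> 0 <= t <= 1 -> K (p + t%:C *: (z - p)).
  move=> [s sr ps] [s' s'r zs'] /andP[t0 t1].
  have -> : p + t%:C *: (z - p) = (1 - t)%:C *: p + t%:C *: z.
    by rewrite rmorphB /= scalerBl scale1r scalerBr addrA addrAC.
  exists ((1 - t) * s + t * s').
    have := ler_wpM2l t0 s'r; have : (1 - t) * s <= (1 - t) * r.
      by rewrite ler_wpM2l // subr_ge0.
    by lra.
  have := atomic_sumZ hT l (1 - t)%:C _ _ ps; rewrite modulus_real ?subr_ge0 // => ps'.
  have := atomic_sumZ hT l t%:C _ _ zs'; rewrite modulus_real //.
  exact: atomic_sumD.
have Kr z : K z -> rnorm z <= r.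
  by move=> [s sr zs]; exact: le_trans (rnorm_atomic_sum _ _ zs) sr.
(* Adding a decomposition of [xi - z] of cost at most [C * rnorm (xi - z)] to one of [z] yields one
   of [xi], of cost at least [r + d]. The denominator [C + 1] stays positive when [C = 0]. *)
have Kd z : K z -> d / (C + 1) <= rnorm (xi - z).
  move=> [s sr zs]; have [s' zs' s'C] := Cbd (xi - z).
  have := atomic_sumD _ _ _ _ zs zs'; rewrite addrC subrK => /rxi h.
  rewrite ler_pdivrMr; last by lra.
  have := rnorm_ge0 (xi - z); lra.
have dC : 0 < d / (C + 1) by rewrite divr_gt0 //; lra.
have [eta [c [cxi Kc]]] := separation K xi r _ (ex_intro _ 0 K0) Kconv Kr dC Kd.
(* Since 0 lies in [K], the level [c] is nonnegative and [q] is positive. Scaling [eta] by [r / q]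
   then brings the real part of its pairing with [xi] to [r]. *)
have c0 : 0 <= c by have := Kc _ K0; rewrite hdot0l.
set q := complex.Re _ in cxi.
have q0 : 0 < q by exact: le_lt_trans cxi.
have rq : 0 <= r / q by rewrite divr_ge0 ?ltW.
exists ((r / q)%:C *: eta); split.
  apply: ge_ereal_sup => _ [_ [x [x1 ->]] <-]; rewrite lee_fin.
  rewrite hdotZl modulusM modulus_real //.
  (* [r * a] times a unit tensor lies in [K] and has real pairing with [eta], so
     [r * modulus (hdot (tens x) eta) <= c < q]. *)
  have [a a1 aE] := exists_phase (hdot (tens x) eta).
  have : K ((r%:C * a) *: tens x).
    exists (modulus (r%:C * a) * rnorm (tens x)); last first.
      by apply: (atomic_sumZ hT l); exact: atomic_sum_tens.
    rewrite (rnorm_tens hT) big1 // mulr1 modulusM (modulus_real _ (ltW r0)).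
    by rewrite ger_pMr.
  move=> /Kc; rewrite hdotZl -mulrA aE Re_realM /= modulus_hdotC => rc.
  by rewrite mulrAC ler_pdivrMr // mul1r; lra.
rewrite hdotZr modulusM modulus_conj modulus_real //.
rewrite mulrAC ler_pdivlMr // ler_pM2l //; exact: Re_le_modulus.
Qed.

Lemma dual_normV_eq xi : dual_normV tens xi = projective_norm tens xi.
Proof.
apply/eqP; rewrite eq_le; apply/andP; split.
  apply: ge_ereal_sup => _ [eta eta1 <-].
  rewrite -[leRHS]mul1e.
  exact: normV_pairing.
have [s0 xis0] := exists_atomic_sum xi.
have p0 : (0 <= projective_norm tens xi)%E.
  apply: le_projective_norm => s /rnorm_atomic_sum xis.
  by rewrite lee_fin (le_trans (rnorm_ge0 _) xis).
have pfin : projective_norm tens xi \is a fin_num.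
  by rewrite ge0_fin_numE // (le_lt_trans (projective_norm_le _ _ xis0)) ?ltry.
rewrite -(fineK pfin); set p := fine _.
have ps s : atomic_sum xi s -> p <= s.
  by move=> /projective_norm_le; rewrite -(fineK pfin) lee_fin.
have D0 : (0 <= dual_normV tens xi)%E.
  apply: ereal_sup_ubound; exists 0; last by rewrite hdot0r modulus0.
  by apply: le_trans (normV_le_rnorm 0) _; rewrite rnorm0 lee_fin.
have Dr r : 0 < r -> r < p -> (r%:E <= dual_normV tens xi)%E.
  move=> r0 rp; have [||s /ps psx|eta [eta1 reta]] := @dual_normV_witness xi r (p - r) => //.
  - by rewrite subr_gt0.
  - by rewrite addrC subrK.
  apply: (@le_trans _ _ (modulus (hdot xi eta))%:E); first by rewrite lee_fin.
  by apply: ereal_sup_ubound; exists eta.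
apply/lee_addgt0Pr => e e0.
rewrite -leeBlDr // -EFinB.
(* The witness lemma needs a positive radius; for [p - e <= 0] nonnegativity of [dual_normV]
   suffices. *)
have [pe|pe] := leP (p - e) 0; first by apply: le_trans D0; rewrite lee_fin.
by apply: Dr => //; lra.
Qed.

End FiniteSlots.
End TensorNorms.

Theorem theorem8p2 (R : realType) (N : nat) (hN : (1 < N)%N)
  (H : 'I_N -> hilbertType R)
  (hpos : forall k : 'I_N, (1 <= hdim (H k))%E)
  (hmono : forall k l : 'I_N, (k <= l)%N -> (hdim (H k) <= hdim (H l))%E)
  (hfin : forall k : 'I_N, k.+2 = N -> (hdim (H k) < +oo)%E)
  (T : hilbertType R) (tens : (forall k : 'I_N, H k) -> T)
  (hT : hilbert_tensor_product tens) :
  (forall xi : T, exists! F : T -> complex R, defines_F tens xi F) /\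
  (forall (xi : T) (F : T -> complex R), defines_F tens xi F ->
     normV tens xi = projective_dual_norm tens F) /\
  (forall xi : T, dual_normV tens xi = projective_norm tens xi).
Proof.
case: N => [//|[//|n]] in hN H hpos hmono hfin tens hT *.
(* Slot [n] is the next to last; its finite dimension dominates those of all earlier slots by
   monotonicity. *)
have fin (k : 'I_n.+2) : k != ord_max -> (hdim (H k) < +oo)%E.
  rewrite -val_eqE /= => kl.
  have kn : (k < n.+1)%N by rewrite ltn_neqAle kl -ltnS ltn_ord.
  have nn : (n < n.+2)%N by exact: ltnW.
  apply: (Order.POrderTheory.le_lt_trans (hmono k (Ordinal nn) kn)).
  exact: hfin.
have lN : (ord_max : 'I_n.+2).+1 = n.+2 by [].
split=> [xi|].
  exists (fun z => hdot z xi); split=> [|F FF].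
    exact: (defines_F_hdot hT ord_max lN fin).
  by rewrite (defines_F_unique hT ord_max lN fin xi F FF).
split=> [xi F FF|xi].
  rewrite (defines_F_unique hT ord_max lN fin xi F FF).
  apply: (normV_eq_dual hT isT ord_max lN fin).
  pose x k := sval (cid (hdim_unit_vector (hpos k))).
  by exists (tens x), x; split=> // k; exact: svalP (cid (hdim_unit_vector (hpos k))).
exact: (dual_normV_eq hT isT ord_max lN fin).
Qed.
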